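(* For every $n\geq 3$ we have $\widetilde{g}_s^w(n)=2n$. Equivalently, the largest cardinality of a weakly convex set $X\subseteq A+A=\{a+a'\mid a,a'\in A\}$, where $A$ ranges over strictly convex sets of $n$ points in the plane, is $2n$.
   Context: A finite point set $X\subseteq\mathbb{R}^2$ is strictly convex if every point of $X$ is a vertex of its convex hull, and weakly convex if $X$ lies on the boundary of its convex hull. A drawing of a graph is a map of its vertices to $\mathbb{R}^2$, edges drawn as straight segments, such that no two vertices coincide, no two edge midpoints coincide, and no edge midpoint coincides with a vertex. $\widetilde{g}_s^w(n)$ is the maximum of $m+n'$ over all $n$-vertex graphs $G$ with $m$ edges, all drawings of $G$ whose vertex set is strictly convex and whose set of edge midpoints is weakly convex, and all sets $S$ of $n'$ vertices of $G$ such that the set of edge midpoints together with (the positions of) the vertices in $S$ is weakly convex. *)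

(* Defs.v *)
From HB Require Import structures.
From mathcomp Require Import all_boot all_order all_algebra.
From mathcomp Require Import all_classical all_reals all_analysis.

Set Implicit Arguments.
Unset Strict Implicit.
Unset Printing Implicit Defensive.

Import Order.TTheory GRing.Theory Num.Theory.
Import numFieldNormedType.Exports.

Local Open Scope classical_set_scope.
Local Open Scope ring_scope.

Section Plane.
Variable R : realType.

Definition conv_hull (X : set 'rV[R]_2) : set 'rV[R]_2 :=
  smallest (@convex_set R 'rV[R]_2) X.

Definition boundary (C : set 'rV[R]_2) : set 'rV[R]_2 :=
  closure C `\` interior C.

(* A vertex of a polygon (possibly degenerate) is an extreme point of it. *)
Definition is_vertex (C : set 'rV[R]_2) (x : 'rV[R]_2) : Prop :=
  C x /\ forall (y z : 'rV[R]_2) (t : R), C y -> C z -> 0 < t < 1 ->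
    x = t *: y + (1 - t) *: z -> y = x /\ z = x.

Definition strictly_convex (X : set 'rV[R]_2) : Prop :=
  X `<=` is_vertex (conv_hull X).

Definition weakly_convex (X : set 'rV[R]_2) : Prop :=
  X `<=` boundary (conv_hull X).

End Plane.

Section Drawings.
Variables (R : realType) (T : finType).

(* A simple graph on the vertex set T is given by its set of edges. *)
Definition is_graph (E : {set {set T}}) : Prop :=
  forall e, e \in E -> #|e| = 2%N.

(* For an edge e = {u, v} this is (p u + p v) / 2. *)
Definition midpoint (p : T -> 'rV[R]_2) (e : {set T}) : 'rV[R]_2 :=
  2^-1 *: \sum_(v in e) p v.

Definition is_drawing (E : {set {set T}}) (p : T -> 'rV[R]_2) : Prop :=
  [/\ injective p,
      {in E &, injective (midpoint p)} &
      forall e v, e \in E -> midpoint p e <> p v].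

Definition midpoints (E : {set {set T}}) (p : T -> 'rV[R]_2) : set 'rV[R]_2 :=
  midpoint p @` [set` E].

End Drawings.

Definition is_maximum (A : set nat) (k : nat) : Prop := A k /\ ubound A k.

(* The values m + n' whose maximum is \widetilde{g}_s^w(n). *)
Definition gsw_values (R : realType) (n : nat) : set nat :=
  [set k | exists (T : finType) (E : {set {set T}}) (p : T -> 'rV[R]_2)
             (S : {set T}),
     [/\ #|T| = n /\ is_graph E,
         is_drawing E p,
         strictly_convex (range p),
         weakly_convex (midpoints E p) &
         weakly_convex (midpoints E p `|` p @` [set` S])
         /\ k = (#|E| + #|S|)%N]].

Definition is_gsw (R : realType) (n k : nat) : Prop :=
  is_maximum (gsw_values R n) k.

Definition sumset_values (R : realType) (n : nat) : set nat :=
  [set k | exists A X : set 'rV[R]_2,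
     [/\ (A #= `I_n)%card, strictly_convex A,
         X `<=` [set a + a' | a in A & a' in A],
         weakly_convex X & (X #= `I_k)%card]].

(* Main.v *)
(* Upper bound: view X as a graph (with loops) on A, an edge a a' standing for
   a + a' in X, and give every vertex two slots, one for each extreme edge in
   the angular order around it; a loop takes one slot of its vertex. An edge
   a a' without a slot has neighbours of a and of a' (or loops at a, a') on
   both sides of the line a a'. As a and a' are extreme points of conv A, then
   a + a' is a positive combination of points of X that affinely span the
   plane, hence interior to conv X. So |X| <= 2n.
   Lower bound: a strictly convex n-gon, taken with vertices (i, i^2), all its
   vertices and the midpoints of all its sides. *)

Require Import Defs.
From mathcomp Require Import all_boot all_order all_algebra.
From mathcomp Require Import all_classical all_reals all_analysis.
From mathcomp Require Import ring lra zify.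

Set Implicit Arguments.
Unset Strict Implicit.
Unset Printing Implicit Defensive.

Import Order.TTheory GRing.Theory Num.Theory.
Import numFieldNormedType.Exports.

Local Open Scope classical_set_scope.
Local Open Scope ring_scope.

(** * Planar orientations, interior points and extreme points of convex sets *)

Section Plane.
Variable R : realType.
Implicit Types (a b c u v w x y z : 'rV[R]_2) (A C X : set 'rV[R]_2).

Lemma rV2_eq x y : x 0 0 = y 0 0 -> x 0 1 = y 0 1 -> x = y.
Proof.
move=> e0 e1; apply/rowP => i; case: i => [[|[|//]] lti].
  by rewrite (_ : Ordinal lti = 0) //; apply: val_inj.
by rewrite (_ : Ordinal lti = 1) //; apply: val_inj.
Qed.

Definition cross u v : R := u 0 0 * v 0 1 - u 0 1 * v 0 0.

(** Twice the signed area of the triangle [a b c]: its sign says on which side of the directed line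
    from [a] to [b] the point [c] lies. *)
Definition orient a b c : R := cross (b - a) (c - a).

Lemma orient_swap a b c : orient a c b = - orient a b c.
Proof. by rewrite /orient /cross !mxE; ring. Qed.

Lemma orient_rev a b c : orient b a c = - orient a b c.
Proof. by rewrite /orient /cross !mxE; ring. Qed.

Lemma orient_aba a b : orient a b a = 0.
Proof. by rewrite /orient /cross !mxE; ring. Qed.

(** Cramer's rule as a linear relation between three plane vectors; the explicit weights in the cone
    arguments below come from it. *)
Lemma cross_cramer u v w :
  cross v w *: u + cross w u *: v + cross u v *: w = 0.
Proof. by apply: rV2_eq; rewrite /cross !mxE; ring. Qed.

Lemma convex_set_comb C x y (s t : R) : convex_set C -> C x -> C y ->
  0 <= s -> 0 <= t -> 0 < s + t ->
  C ((s / (s + t)) *: x + (t / (s + t)) *: y).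
Proof.
move=> cC Cx Cy s0 t0 st0.
have t1 : t / (s + t) = 1 - s / (s + t) by field; rewrite gt_eqF.
have k0 : 0 <= s / (s + t) by rewrite divr_ge0 // ltW.
have k1 : s / (s + t) <= 1 by rewrite ler_pdivrMr // mul1r lerDl.
have := cC x y (Itv01 k0 k1).
by rewrite !inE t1 => /(_ Cx Cy).
Qed.

Lemma conv_hull_convex X : convex_set (conv_hull X).
Proof.
move=> x y k; rewrite !inE => hx hy M [cM XM].
by have := cM x y k; rewrite !inE; apply; [exact: hx|exact: hy].
Qed.

Lemma sub_conv_hull X : X `<=` conv_hull X.
Proof. exact: sub_gen_smallest. Qed.

(** The expression is affine in [v] and equals [c] at [v = x], so continuity keeps it positive
    nearby. *)
Lemma near_pos_cross x y z (c k1 k2 : R) : 0 < c ->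
  \forall v \near x, 0 < c + k1 * cross (v - x) y + k2 * cross z (v - x).
Proof.
move=> c0.
pose a0 := k1 * y 0 1 - k2 * z 0 1; pose a1 := k2 * z 0 0 - k1 * y 0 0.
pose f (v : 'rV[R]_2) : R := c + (a0 * (v 0 0 - x 0 0) + a1 * (v 0 1 - x 0 1)).
have fE v : c + k1 * cross (v - x) y + k2 * cross z (v - x) = f v.
  by rewrite /f /a0 /a1 /cross !mxE; ring.
have fx : f x = c by rewrite /f !subrr !mulr0 !addr0.
pose e (i : 'I_2) (v : 'rV[R]_2) : R := v 0 i.
have ce i : {for x, continuous (e i)} by exact: coord_continuous.
have cc (k : R) : {for x, continuous (cst k : 'rV[R]_2 -> R)}.
  exact: cst_continuous.
have cf : {for x, continuous f} :=
  continuousD (cc c) (continuousD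
    (continuousM (cc a0) (continuousB (ce 0) (cc (x 0 0))))
    (continuousM (cc a1) (continuousB (ce 1) (cc (x 0 1))))).
have fx0 : 0 < f x by rewrite fx.
by apply: filterS (cvgr_gt _ cf 0 fx0) => v; rewrite fE.
Qed.

(** The relation writes [x] as a convex combination of the [y]s with all weights positive. Two
    independent directions suffice to reach any nearby [v] by a small change of these weights, which
    keeps them positive. *)
Lemma interior_pos_comb C x y1 y2 y3 y4 (l1 l2 l3 l4 : R) : convex_set C ->
  C y1 -> C y2 -> C y3 -> C y4 -> 0 < l1 -> 0 < l2 -> 0 < l3 -> 0 < l4 ->
  l1 *: (y1 - x) + l2 *: (y2 - x) + l3 *: (y3 - x) + l4 *: (y4 - x) = 0 ->
  cross (y1 - x) (y2 - x) != 0 -> interior C x.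
Proof.
move=> cC C1 C2 C3 C4 p1 p2 p3 p4 E D0.
set D := cross _ _ in D0; pose L := l1 + l2 + l3 + l4.
have L0 : 0 < L by rewrite /L !addr_gt0.
(* By Cramer's rule [s1 v] and [s2 v] are the coordinates of [v - x] in the basis [y1 - x],
   [y2 - x]. The factor [r v] on the zero combination makes the weights [l1 * r v + s1 v],
   [l2 * r v + s2 v], [l3 * r v], [l4 * r v] sum to 1. *)
pose s1 v := cross (v - x) (y2 - x) / D.
pose s2 v := cross (y1 - x) (v - x) / D.
pose r v := (1 - s1 v - s2 v) / L.
have nr (l k1 k2 : R) : 0 < l ->
    \forall v \near x, 0 < l * r v + k1 * s1 v + k2 * s2 v.
  move=> l0; have := @near_pos_cross x (y2 - x) (y1 - x) (l / L)
    ((k1 - l / L) / D) ((k2 - l / L) / D) (divr_gt0 l0 L0).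
  apply: filterS => v; congr (0 < _); rewrite /r /s1 /s2; field.
  by rewrite D0 gt_eqF.
rewrite /interior /=; near=> v.
have m1 : 0 < l1 * r v + 1 * s1 v + 0 * s2 v by near: v; exact: nr.
have m2 : 0 < l2 * r v + 0 * s1 v + 1 * s2 v by near: v; exact: nr.
have m3 : 0 < l3 * r v + 0 * s1 v + 0 * s2 v by near: v; exact: nr.
have m4 : 0 < l4 * r v + 0 * s1 v + 0 * s2 v by near: v; exact: nr.
set n1 := _ + _ in m1; set n2 := _ + _ in m2.
set n3 := _ + _ in m3; set n4 := _ + _ in m4.
have rL : r v * L = 1 - s1 v - s2 v by rewrite /r mulfVK // gt_eqF.
have sum1 : n1 + n2 + (n3 + n4) = 1.
  transitivity (r v * L + s1 v + s2 v); first by rewrite /n1 /n2 /n3 /n4 /L; ring.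
  by rewrite rL; ring.
have C12 := convex_set_comb cC C1 C2 (ltW m1) (ltW m2) (addr_gt0 m1 m2).
have C34 := convex_set_comb cC C3 C4 (ltW m3) (ltW m4) (addr_gt0 m3 m4).
have p12 := addr_gt0 m1 m2; have p34 := addr_gt0 m3 m4.
have := convex_set_comb cC C12 C34 (ltW p12) (ltW p34) (addr_gt0 p12 p34).
rewrite sum1 !divr1 !scalerDr !scalerA ![_ * (_ / _)]mulrC !divfK ?gt_eqF //.
suff -> : v = n1 *: y1 + n2 *: y2 + (n3 *: y3 + n4 *: y4) by [].
have coordE (i : 'I_2) : v 0 i = x 0 i + s1 v * (y1 - x) 0 i + s2 v * (y2 - x) 0 i.
  have : D *: (v - x) =
      cross (v - x) (y2 - x) *: (y1 - x) + cross (y1 - x) (v - x) *: (y2 - x).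
    by apply: rV2_eq; rewrite /D /cross !mxE; ring.
  move/rowP/(_ i); rewrite !mxE => e; apply: (mulfI D0).
  by rewrite -[v 0 i](subrK (x 0 i)) mulrDr e /s1 /s2; field.
have key (i : 'I_2) :
    v 0 i = n1 * y1 0 i + n2 * y2 0 i + (n3 * y3 0 i + n4 * y4 0 i).
  move/rowP: E => /(_ i); rewrite !mxE => Ei; rewrite coordE !mxE.
  transitivity ((n1 + n2 + (n3 + n4)) * x 0 i + r v * (l1 * (y1 0 i - x 0 i) +
    l2 * (y2 0 i - x 0 i) + l3 * (y3 0 i - x 0 i) + l4 * (y4 0 i - x 0 i))
    + s1 v * (y1 0 i - x 0 i) + s2 v * (y2 0 i - x 0 i)).
    by rewrite sum1 Ei; ring.
  by rewrite /n1 /n2 /n3 /n4; ring.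
by apply: rV2_eq; rewrite !mxE; exact: key.
Unshelve. all: by end_near. Qed.

(** The points [y1] and [y3] merge into one point of [C], and [x] lies strictly between it and [y2],
    so extremality applies. Allowing [l1 = 0] covers relations between two points. *)
Lemma vertex_pos_comb C x y1 y2 y3 (l1 l2 l3 : R) : convex_set C ->
  is_vertex C x -> C y1 -> C y2 -> C y3 -> 0 <= l1 -> 0 < l2 -> 0 < l3 ->
  l1 *: (y1 - x) + l2 *: (y2 - x) + l3 *: (y3 - x) = 0 -> y2 = x.
Proof.
move=> cC [_ ext] C1 C2 C3 p1 p2 p3 E.
have p13 : 0 < l1 + l3 by rewrite ltr_wpDl.
have C13 := convex_set_comb cC C1 C3 p1 (ltW p3) p13.
have p : 0 < l2 + (l1 + l3) by rewrite addr_gt0.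
have t01 : 0 < l2 / (l2 + (l1 + l3)) < 1.
  by rewrite divr_gt0 //= ltr_pdivrMr // mul1r ltrDl.
case: (ext _ _ _ C2 C13 t01) => //.
have key (i : 'I_2) : (l2 + (l1 + l3)) * x 0 i =
    l1 * y1 0 i + l2 * y2 0 i + l3 * y3 0 i.
  move/rowP: E => /(_ i); rewrite !mxE => Ei.
  by rewrite -[RHS](subr0) -Ei; ring.
suff coordE (i : 'I_2) : x 0 i = l2 / (l2 + (l1 + l3)) * y2 0 i
    + (1 - l2 / (l2 + (l1 + l3))) *
      (l1 / (l1 + l3) * y1 0 i + l3 / (l1 + l3) * y3 0 i).
  by apply: rV2_eq; rewrite !mxE; exact: coordE.
apply: (mulfI (lt0r_neq0 p)); rewrite key; field.
by rewrite !gt_eqF.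
Qed.

(** Of three distinct collinear points one lies strictly between the other two, hence is not
    extreme. *)
Lemma strictly_convex_orient_neq0 A a b c : strictly_convex A ->
  A a -> A b -> A c -> a != b -> a != c -> b != c -> orient a b c != 0.
Proof.
move=> sA Aa Ab Ac ab ac bc; apply/eqP => o0.
have hull := @sub_conv_hull A; have cH := @conv_hull_convex A.
pose q := (b 0 0 - a 0 0) ^+ 2 + (b 0 1 - a 0 1) ^+ 2.
have q0 : q != 0.
  apply: contra ab; rewrite paddr_eq0 ?sqr_ge0 // !sqrf_eq0 !subr_eq0.
  by case/andP => /eqP e0 /eqP e1; apply/eqP/rV2_eq.
(* The coefficient of the orthogonal projection of [c - a] on [b - a]; by collinearity
   [c = a + t (b - a)]. The position of [t] relative to 0 and 1 tells which point is the middle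
   one. *)
pose t := ((b 0 0 - a 0 0) * (c 0 0 - a 0 0)
  + (b 0 1 - a 0 1) * (c 0 1 - a 0 1)) / q.
have ct (i : 'I_2) : c 0 i = a 0 i + t * (b 0 i - a 0 i).
  suff : c - a = t *: (b - a).
    by move/rowP/(_ i); rewrite !mxE => <-; ring.
  move: o0; rewrite /orient /cross !mxE => /eqP; rewrite subr_eq0 => /eqP o0.
  apply: rV2_eq; rewrite !mxE /t; apply: (mulfI q0).
    rewrite mulrA mulrCA mulfV // mulr1 /q.
    transitivity ((b 0 0 - a 0 0) ^+ 2 * (c 0 0 - a 0 0) +
      (b 0 1 - a 0 1) * ((b 0 1 - a 0 1) * (c 0 0 - a 0 0))); first by ring.
    by rewrite -o0; ring.
  rewrite mulrA mulrCA mulfV // mulr1 /q.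
  transitivity ((b 0 0 - a 0 0) * ((b 0 0 - a 0 0) * (c 0 1 - a 0 1)) +
    (b 0 1 - a 0 1) ^+ 2 * (c 0 1 - a 0 1)); first by ring.
  by rewrite o0; ring.
have nocomb x y z (l2 l3 : R) : A x -> A y -> A z -> y != x ->
    0 < l2 -> 0 < l3 -> l2 *: (y - x) + l3 *: (z - x) = 0 -> False.
  move=> Ax Ay Az yx p2 p3 E; move/eqP: yx; apply.
  apply: (@vertex_pos_comb (conv_hull A) x x y z 0 l2 l3) => //;
    [exact: sA|exact: hull|exact: hull|exact: hull|].
  by rewrite scale0r add0r.
case: (ltgtP t 0) => t0.
- apply: (@nocomb a b c (- t) 1) => //; rewrite ?oppr_gt0 1?eq_sym //.
  by apply: rV2_eq; rewrite !mxE ct; ring.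
- case: (ltgtP t 1) => t1.
  + apply: (@nocomb c a b (1 - t) t) => //; rewrite ?subr_gt0 //.
    by apply: rV2_eq; rewrite !mxE !ct; ring.
  + apply: (@nocomb b a c (t - 1) 1) => //; rewrite ?subr_gt0 //.
    by apply: rV2_eq; rewrite !mxE !ct; ring.
  + by case/eqP: bc; apply: rV2_eq; rewrite !ct t1; ring.
- by case/eqP: ac; apply: rV2_eq; rewrite !ct t0; ring.
Qed.

(* By extremality of [a], the ray from [a] to [a'] runs inside the angle
   spanned by two points on opposite sides of the line [a a']. *)
Lemma strictly_convex_cone A a a' b c : strictly_convex A ->
  A a -> A a' -> A b -> A c -> 0 < orient a a' b -> orient a a' c < 0 ->
  orient a b c < 0.
Proof.
move=> sA Aa Aa' Ab Ac ob oc; rewrite ltNge; apply/negP => D0.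
have hull := @sub_conv_hull A.
suff ba : b = a by move: ob; rewrite ba orient_aba ltxx.
apply: (@vertex_pos_comb (conv_hull A) a a' b c (orient a b c)
  (- orient a a' c) (orient a a' b)); rewrite ?oppr_gt0 //.
- exact: conv_hull_convex.
- exact: sA.
- exact: hull.
- exact: hull.
- exact: hull.
- by rewrite -orient_swap; exact: cross_cramer.
Qed.

End Plane.

(** * Sums [a + a'] forced into the interior *)

Section InteriorSums.
Variable R : realType.
Implicit Types (a b c u v w x y z : 'rV[R]_2) (A C X : set 'rV[R]_2).

(** Seen from [a + a'], the point [a' + b'] lies in direction [b' - a]. So the two sums at [a'] span
    a cone around [a' - a], and the two sums at [a] a cone around [a - a']. Cramer's rule gives
    positive combinations along these opposite vectors, scaled so as to cancel. *)
Lemma interior_sum_cone_cone A C a a' b c b' c' :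
  strictly_convex A -> convex_set C ->
  A a -> A a' -> A b -> A c -> A b' -> A c' ->
  C (a + b) -> C (a + c) -> C (a' + b') -> C (a' + c') ->
  0 < orient a a' b -> orient a a' c < 0 ->
  0 < orient a a' b' -> orient a a' c' < 0 ->
  interior C (a + a').
Proof.
move=> sA cC Aa Aa' Ab Ac Ab' Ac' Cb Cc Cb' Cc' ob oc ob' oc'.
have D0 := strictly_convex_cone sA Aa Aa' Ab' Ac' ob' oc'.
have D1 : orient a' c b < 0.
  apply: (strictly_convex_cone sA Aa' Aa) => //.
    by rewrite orient_rev oppr_gt0.
  by rewrite orient_rev oppr_lt0.
apply: (@interior_pos_comb _ C (a + a') (a' + b') (a' + c') (a + c) (a + b)
  (orient a' c b * orient a a' c') (- orient a' c b * orient a a' b')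
  (orient a b' c' * - orient a a' b) (orient a b' c' * orient a a' c)) => //.
- by rewrite nmulr_lgt0.
- by rewrite pmulr_lgt0 // oppr_gt0.
- by rewrite nmulr_lgt0 // oppr_lt0.
- by rewrite nmulr_lgt0.
- by apply: rV2_eq; rewrite /orient /cross !mxE; ring.
- suff -> : cross (a' + b' - (a + a')) (a' + c' - (a + a')) = orient a b' c'.
    by rewrite lt_eqF.
  by rewrite /orient /cross !mxE; ring.
Qed.

(** The loop [a + a] lies in direction [a - a'] from [a + a'] and replaces a whole cone; it is used
    twice to supply four points. *)
Lemma interior_sum_double_cone A C a a' b c :
  strictly_convex A -> convex_set C -> A a -> A a' -> A b -> A c ->
  C (a + a) -> C (a' + b) -> C (a' + c) ->
  0 < orient a a' b -> orient a a' c < 0 ->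
  interior C (a + a').
Proof.
move=> sA cC Aa Aa' Ab Ac Ca Cb Cc ob oc.
have D0 := strictly_convex_cone sA Aa Aa' Ab Ac ob oc.
apply: (@interior_pos_comb _ C (a + a') (a' + b) (a' + c) (a + a) (a + a)
  (2 * - orient a a' c) (2 * orient a a' b)
  (- orient a b c) (- orient a b c)) => //.
- by rewrite mulr_gt0 // oppr_gt0.
- by rewrite mulr_gt0.
- by rewrite oppr_gt0.
- by rewrite oppr_gt0.
- by apply: rV2_eq; rewrite /orient /cross !mxE; ring.
- suff -> : cross (a' + b - (a + a')) (a' + c - (a + a')) = orient a b c.
    by rewrite lt_eqF.
  by rewrite /orient /cross !mxE; ring.
Qed.

(** The loops give both directions along the line [a a'], the other two sums point to opposite sides
    of it. Weighted so that their transversal parts cancel, these two leave [- d (a' - a)], which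
    the loops compensate. *)
Lemma interior_sum_double_double C a a' b c : convex_set C ->
  C (a + a) -> C (a' + a') -> C (a' + b) -> C (a + c) ->
  0 < orient a a' b -> orient a a' c < 0 ->
  interior C (a + a').
Proof.
move=> cC Ca Ca' Cb Cc ob oc.
pose d := cross (b - a) (c - a').
(* Adding this amount to both loop weights changes nothing in the sum and makes both positive. *)
have K0 : 0 < `|d| + 1 by rewrite ltr_wpDl.
apply: (@interior_pos_comb _ C (a + a') (a' + b) (a' + a') (a + c) (a + a)
  (- orient a a' c) (d + (`|d| + 1)) (orient a a' b) (`|d| + 1)) => //.
- by rewrite oppr_gt0.
- have : - d <= `|d| by rewrite -normrN ler_norm.
  by lra.
- by apply: rV2_eq; rewrite /orient /d /cross !mxE; ring.
- suff -> : cross (a' + b - (a + a')) (a' + a' - (a + a')) = - orient a a' b.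
    by rewrite oppr_eq0 gt_eqF.
  by rewrite /orient /cross !mxE; ring.
Qed.

End InteriorSums.

(** * Charging sums to vertex slots *)

Section Charging.
Variables (R : realType) (T : finType) (p : T -> 'rV[R]_2) (X : set 'rV[R]_2).

Definition on_side (s : bool) (r : R) : bool := if s then 0 < r else r < 0.

(* The slots [(a, s)] of a vertex [a] can hold its edges [a a'] which are
   extreme on the side [s]; if [p a + p a] is in [X], it takes the slot
   [(a, true)]. *)
Definition charged (x : 'rV[R]_2) (slot : T * bool) : Prop :=
  let: (a, s) := slot in
  (s /\ x = p a + p a) \/
  exists a', [/\ a' != a, x = p a + p a', X (p a + p a) -> ~~ s &
    forall b, X (p a + p b) -> ~~ on_side s (orient (p a) (p a') (p b))].

Hypotheses (pI : injective p) (sA : strictly_convex (range p)).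

Let orient_neq0 a b c : a != b -> a != c -> b != c ->
  orient (p a) (p b) (p c) != 0.
Proof.
have Ap t : range p (p t) by exists t.
by move=> ab ac bc; apply: (strictly_convex_orient_neq0 sA) => //;
  rewrite inj_eq.
Qed.

(** For distinct [b] and [c], [orient a b c] and [orient a c b] are nonzero and opposite, so one of
    the edges [a b], [a c] is not extreme on side [s]. A loop bars all edges from its slot. *)
Lemma charged_inj x y slot :
  X x -> X y -> charged x slot -> charged y slot -> x = y.
Proof.
case: slot => a s Xx Xy; case=> [[s1 xE]|[b [ba xE bs bfree]]];
  case=> [[s1' yE]|[c [ca yE cs cfree]]].
- by rewrite xE yE.
- by move: cs; rewrite s1 -xE => /(_ Xx).
- by move: bs; rewrite s1' -yE => /(_ Xy).
have [bc|bc] := eqVneq b c; first by rewrite xE yE bc.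
move: (bfree c); rewrite -yE => /(_ Xy) bc0.
move: (cfree b); rewrite -xE => /(_ Xx); rewrite orient_swap => cb0.
have : orient (p a) (p b) (p c) != 0 by rewrite orient_neq0 // eq_sym.
by case: s {bs cs bfree cfree} bc0 cb0;
  rewrite /on_side ?oppr_gt0 ?oppr_lt0 neq_lt => /negbTE-> /negbTE->.
Qed.

Hypothesis wX : weakly_convex X.

(** If no slot holds the edge, each slot of [a] or [a'] not taken by a loop yields a neighbour on
    its side. The cases by loops then match the interior lemmas. *)
Lemma charged_ex a a' : X (p a + p a') ->
  exists slot, charged (p a + p a') slot.
Proof.
have [<-|aa'] := eqVneq a a'; first by exists (a, true); left.
move=> Xx; apply: contrapT => /forallNP nslot.
have [_ /= nint] := wX Xx; apply: nint.
have sub := @sub_conv_hull R X; have cH := @conv_hull_convex R X.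
have Ap b : range p (p b) by exists b.
have obstr s : (X (p a + p a) -> ~~ s) ->
    exists2 b, X (p a + p b) & on_side s (orient (p a) (p a') (p b)).
  move=> hs; apply: contrapT => /forall2NP hb; apply: (nslot (a, s)).
  right; exists a'; split; rewrite 1?eq_sym // => b Xb.
  by case: (hb b) => // /negP.
have obstr' s : (X (p a' + p a') -> ~~ s) ->
    exists2 b, X (p a' + p b) & on_side s (- orient (p a) (p a') (p b)).
  move=> hs; apply: contrapT => /forall2NP hb; apply: (nslot (a', s)).
  right; exists a; split => //; first by rewrite addrC.
  by move=> b Xb; rewrite orient_rev; case: (hb b) => // /negP.
have [La|La] := pselect (X (p a + p a)); have [La'|La'] := pselect (X (p a' + p a')).
(* Both loops occupy a [true] slot. The line is read in opposite directions from its two ends, so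
   the remaining [false] slots face opposite sides of it. *)
- have [//|c Xc /= oc] := obstr false.
  have [//|b Xb /=] := obstr' false; rewrite oppr_lt0 => ob.
  by apply: (interior_sum_double_double cH _ _ _ _ ob oc); exact: sub.
- have [//|c Xc /=] := obstr' true; rewrite oppr_gt0 => oc.
  have [//|b Xb /=] := obstr' false; rewrite oppr_lt0 => ob.
  by apply: (interior_sum_double_cone sA cH _ _ _ _ _ _ _ ob oc) => //;
    exact: sub.
- have [//|b Xb /= ob] := obstr true; have [//|c Xc /= oc] := obstr false.
  have oc' : 0 < orient (p a') (p a) (p c) by rewrite orient_rev oppr_gt0.
  have ob' : orient (p a') (p a) (p b) < 0 by rewrite orient_rev oppr_lt0.
  by rewrite addrC; apply: (interior_sum_double_cone sA cH _ _ _ _ _ _ _ oc' ob')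
    => //; exact: sub.
- have [//|b Xb /= ob] := obstr true; have [//|c Xc /= oc] := obstr false.
  have [//|c' Xc' /=] := obstr' true; rewrite oppr_gt0 => oc'.
  have [//|b' Xb' /=] := obstr' false; rewrite oppr_lt0 => ob'.
  by apply: (interior_sum_cone_cone sA cH _ _ _ _ _ _ _ _ _ _ ob oc ob' oc')
    => //; exact: sub.
Qed.

End Charging.

(** * The upper bound, by an injection into the slots *)

Lemma weakly_convex_sumset_card (R : realType) (T U : finType)
    (p : T -> 'rV[R]_2) (q : U -> 'rV[R]_2) :
  injective p -> injective q -> strictly_convex (range p) ->
  weakly_convex (range q) -> (forall i, exists a b, q i = p a + p b) ->
  (#|U| <= 2 * #|T|)%N.
Proof.
move=> pI qI sA wX hq.
have /choice[f fP] i : exists slot, charged p (range q) (q i) slot.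
  have [a [b e]] := hq i; rewrite e; apply: charged_ex => //.
  by rewrite -e; exists i.
have fI : injective f.
  move=> i j fij; apply: qI; have fPj := fP j; rewrite -fij in fPj.
  by apply: (charged_inj pI sA _ _ (fP i) fPj); [exists i|exists j].
by have := leq_card f fI; rewrite card_prod card_bool mulnC.
Qed.

Lemma card_eq_range (T : pointedType) (A : set T) (n : nat) :
  (A #= `I_n)%card -> exists2 f : 'I_n -> T, injective f & range f = A.
Proof.
move=> An; have /card_set_bijP[f [fA fI fS]] : ([set: 'I_n] #= A)%card.
  by rewrite card_eq_sym; exact: card_eq_trans An card_II.
exists f; last by apply/seteqP; split => [_ [i _ <-]|//]; exact: fA.
by move=> i j; apply: fI; rewrite inE.
Qed.

Lemma card_range_finType (U : finType) (T : pointedType) (f : U -> T) :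
  injective f -> (range f #= `I_#|U|)%card.
Proof.
move=> fI; rewrite card_eq_sym; apply: (card_eq_trans card_II).
apply/card_set_bijP; exists (f \o enum_val); split.
- by move=> i _; exists (enum_val i).
- by move=> i j _ _ /fI /enum_val_inj.
- by move=> _ [i _ <-]; exists (enum_rank i) => //=; rewrite enum_rankK.
Qed.

Lemma sumset_values_ub (R : realType) (n : nat) :
  ubound (sumset_values R n) (2 * n)%N.
Proof.
move=> k [A [X [An sA sub wX Xk]]].
have [p pI pA] := card_eq_range An; have [q qI qX] := card_eq_range Xk.
rewrite -[X in (X <= _)%O]card_ord -[n]card_ord leEnat.
apply: (weakly_convex_sumset_card pI qI); rewrite ?pA ?qX // => i.
have /sub[a] : X (q i) by rewrite -qX; exists i.
by rewrite -pA => -[a' _ <-] [_ [b' _ <-] <-]; exists a', b'.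
Qed.

(** * From drawings to sumsets by doubling *)

Lemma weakly_convex_double (R : realType) (X : set 'rV[R]_2) :
  weakly_convex X -> weakly_convex [set 2 *: x | x in X].
Proof.
move=> wX _ [x Xx <-]; have [_ nint] := wX _ Xx; split.
  by apply: subset_closure; apply: sub_conv_hull; exists x.
apply: contra_not nint => int2x.
(* Halving maps the hull of the doubled set into the hull of [X], so a neighbourhood of [2 x] would
   pull back to one of [x]. *)
have cvx : convex_set [set w : 'rV[R]_2 | conv_hull X (2^-1 *: w)].
  move=> w z k; rewrite !inE /= => Xw Xz.
  have := @conv_hull_convex R X (2^-1 *: w) (2^-1 *: z) k; rewrite !inE.
  move=> /(_ Xw Xz); congr (conv_hull X _).
  by rewrite /conv /= scalerDr !scalerA ![2^-1 * _]mulrC.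
have sub : conv_hull [set 2 *: x | x in X] `<=`
    [set w : 'rV[R]_2 | conv_hull X (2^-1 *: w)].
  apply: smallest_sub => // _ [w Xw <-] /=.
  by rewrite scalerA mulVf ?scale1r //; exact: sub_conv_hull.
have c2 : {for x, continuous (fun v : 'rV[R]_2 => (2 : R) *: v)}.
  exact: scaler_continuous.
have near2 : \forall v \near x, conv_hull [set 2 *: x | x in X] (2 *: v).
  exact: c2 int2x.
rewrite /interior /=; near=> v.
have /sub /= : conv_hull [set 2 *: x | x in X] (2 *: v) by near: v.
by rewrite scalerA mulVf ?scale1r.
Unshelve. all: by end_near. Qed.

(** Doubling turns the midpoint of an edge into the sum of its ends, and a vertex of [S] into a
    loop. The conditions on a drawing keep all these points distinct, so the cardinality is the
    number of edges plus that of [S]. *)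
Lemma gsw_values_sumset (R : realType) (n : nat) :
  gsw_values R n `<=` sumset_values R n.
Proof.
move=> k [T [E [p [S [[Tn gE] [pI mI mp] sA _ [wX ->]]]]]].
pose q (i : {e | e \in E} + {v | v \in S}) : 'rV[R]_2 :=
  match i with inl e => 2 *: midpoint p (val e) | inr v => 2 *: p (val v) end.
have two0 : (2 : R) != 0 by [].
have qI : injective q.
  case=> [e|v] [e'|v'] /= /(scalerI two0).
  - by move=> eq; congr inl; apply/val_inj/mI => //; exact: valP.
  - by move/mp => /(_ (valP e)).
  - by move/esym/mp => /(_ (valP e')).
  - by move/pI/val_inj => ->.
have qE : range q = [set 2 *: x | x in midpoints E p `|` p @` [set` S]].
  apply/seteqP; split.
    move=> _ [[[e Ee]|[v Sv]] _ <-] /=.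
      by exists (midpoint p e) => //; left; exists e.
    by exists (p v) => //; right; exists v.
  move=> _ [_ [[e /= Ee <-]|[v /= Sv <-]] <-].
    by exists (inl (exist _ e Ee)).
  by exists (inr (exist _ v Sv)).
exists (range p), (range q); split => //.
- by rewrite -Tn; exact: card_range_finType.
- move=> _ [[[e Ee]|[v Sv]] _ <-] /=.
    have /eqP/cards2P[a [b [ab ->]]] := gE _ Ee.
    exists (p a); first by exists a.
    exists (p b); first by exists b.
    by rewrite /midpoint big_setU1 ?inE // big_set1 scalerA mulfV // scale1r.
  exists (p v); first by exists v.
  exists (p v); first by exists v.
  by rewrite scaler_nat mulr2n.
- by rewrite qE; exact: weakly_convex_double.
- by have := card_range_finType qI; rewrite card_sum !card_sig.
Qed.

(** * Supporting lines as certificates of convexity *)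

Section Support.
Variable R : realType.
Implicit Types (u v w x y z : 'rV[R]_2) (A C X : set 'rV[R]_2).

Definition dot u v : R := u 0 0 * v 0 0 + u 0 1 * v 0 1.

Lemma dotDr u v w : dot u (v + w) = dot u v + dot u w.
Proof. by rewrite /dot !mxE; ring. Qed.

Lemma dotZr u (k : R) v : dot u (k *: v) = k * dot u v.
Proof. by rewrite /dot !mxE; ring. Qed.

Lemma dot_gt0 u : u != 0 -> 0 < dot u u.
Proof.
move=> u0; rewrite lt_neqAle addr_ge0 -?expr2 ?sqr_ge0 // andbT eq_sym.
apply: contra u0; rewrite /dot -!expr2 paddr_eq0 ?sqr_ge0 // !sqrf_eq0.
by case/andP => /eqP e0 /eqP e1; apply/eqP/rV2_eq; rewrite mxE.
Qed.

Lemma conv_hull_halfplane X u (c : R) : (forall y, X y -> dot u y <= c) ->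
  forall y, conv_hull X y -> dot u y <= c.
Proof.
move=> h; apply: (@smallest_sub _ _ _ [set y | dot u y <= c]) => //.
move=> y z k; rewrite !inE /= => hy hz; rewrite /conv /= dotDr !dotZr.
have k0 : 0 <= k%:num by [].
have k1 : 0 <= 1 - k%:num by rewrite subr_ge0.
have := lerD (ler_wpM2l k0 hy) (ler_wpM2l k1 hz).
by rewrite -mulrDl [_ + (1 - _)]addrC subrK mul1r.
Qed.

Lemma weakly_convex_support X :
  (forall x, X x -> exists2 u, u != 0 & forall y, X y -> dot u y <= dot u x) ->
  weakly_convex X.
Proof.
move=> h x Xx; split; first by apply: subset_closure; exact: sub_conv_hull.
have [u u0 /conv_hull_halfplane ux] := h _ Xx.
rewrite /interior /= => /nbhs_ballP[e /= e0 xe].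
(* The [+ 1] makes the displacement [t u] strictly shorter than [e]; it still leaves the supporting
   half-plane. *)
pose t : R := e / (`|u| + 1).
have u1 : 0 < `|u| + 1 by rewrite ltr_wpDl.
have t0 : 0 < t by rewrite divr_gt0.
have /xe/ux : ball x e (x + t *: u).
  rewrite -ball_normE /= opprD addrA subrr add0r normrN normrZ gtr0_norm //.
  by rewrite /t mulrAC ltr_pdivrMr // ltr_pM2l // ltrDl.
rewrite dotDr dotZr gerDl leNgt => /negP; apply.
by rewrite mulr_gt0 // dot_gt0.
Qed.

Lemma strictly_convex_support A :
  (forall a, A a -> exists u, forall b, A b -> b != a -> dot u b < dot u a) ->
  strictly_convex A.
Proof.
move=> h a Aa; have [u hu] := h _ Aa.
split; first exact: sub_conv_hull.
(* An open half-plane together with the single boundary point [a] is convex, and [a] is extreme in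
   it. *)
have sub : conv_hull A `<=` [set b | b = a \/ dot u b < dot u a].
  apply: smallest_sub => [|b Ab /=]; last first.
    by have [->|ba] := eqVneq b a; [left|right; exact: hu].
  apply/convex_setW => x y; rewrite !inE /= => hx hy k k0 k1; rewrite inE /=.
  rewrite /conv /= dotDr !dotZr /unstable.onem.
  have k1' : 0 < 1 - k%:num by rewrite subr_gt0.
  case: hx => [->|hx]; case: hy => [->|hy].
  - by left; rewrite -scalerDl [_ + (1 - _)]addrC subrK scale1r.
  - by right; move: hy; rewrite -(ltr_pM2l k1'); lra.
  - by right; move: hx; rewrite -(ltr_pM2l k0); lra.
  - have hkx : k%:num * dot u x < k%:num * dot u a by rewrite ltr_pM2l.
    have hky : (1 - k%:num) * dot u y < (1 - k%:num) * dot u a.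
      by rewrite ltr_pM2l.
    by right; lra.
move=> y z t /sub hy /sub hz /andP[t0 t1] aE.
have t1' : 0 < 1 - t by rewrite subr_gt0.
have := congr1 (dot u) aE; rewrite dotDr !dotZr.
case: hy hz => [->|hy] [->|hz] // e; exfalso.
- have : (1 - t) * dot u z < (1 - t) * dot u a by rewrite ltr_pM2l.
  by lra.
- have : t * dot u y < t * dot u a by rewrite ltr_pM2l.
  by lra.
- have : (1 - t) * dot u z < (1 - t) * dot u a by rewrite ltr_pM2l.
  have : t * dot u y < t * dot u a by rewrite ltr_pM2l.
  by lra.
Qed.

End Support.

(** * The extremal polygon on the parabola *)

Section Parabola.
Variables (R : realType) (n : nat).
Hypothesis hn : (3 <= n)%N.

Definition vec2 (r s : R) : 'rV[R]_2 := \row_j (if j == 0 then r else s).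

Lemma dot_vec2 (r s r' s' : R) : dot (vec2 r s) (vec2 r' s') = r * r' + s * s'.
Proof. by rewrite /dot !mxE. Qed.

Lemma vec2_neq0 (r s : R) : s != 0 -> vec2 r s != 0.
Proof. by apply: contra => /eqP/rowP/(_ 1); rewrite !mxE /= => ->. Qed.

Definition parabola_pt (i : 'I_n) : 'rV[R]_2 := vec2 i%:R (i%:R ^+ 2).

Definition cycle_edge (i : 'I_n) : {set 'I_n} := [set i; ordS i].

Definition cycle_edges : {set {set 'I_n}} := [set cycle_edge i | i : 'I_n].

Lemma val_ordS (i : 'I_n) : val (ordS i) = if (i.+1 < n)%N then i.+1 else 0%N.
Proof.
rewrite /=; case: ltnP => ni; first by rewrite modn_small.
by have -> : i.+1 = n; [have := ltn_ord i; lia|rewrite modnn].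
Qed.

Lemma ordS_neq (i : 'I_n) : i != ordS i.
Proof.
apply/eqP => /(congr1 val); rewrite val_ordS /=.
by case: ltnP => ni; have := ltn_ord i; lia.
Qed.

(** Otherwise [i] and [j] would be cyclic successors of each other, impossible for [n >= 3]. *)
Lemma cycle_edge_inj : injective cycle_edge.
Proof.
move=> i j /setP eij; have := eij i; have := eij j.
rewrite !inE !eqxx /= => /orP[/eqP -> //|/eqP ji] /esym.
move=> /orP[/eqP -> //|/eqP ij].
move: (congr1 val ij) (congr1 val ji); rewrite !val_ordS /=.
by do 2 case: ltnP => ?; have := ltn_ord i; have := ltn_ord j; lia.
Qed.

Lemma cycle_edges_graph : is_graph cycle_edges.
Proof. by move=> _ /imsetP[i _ ->]; rewrite cards2 ordS_neq. Qed.

Lemma card_cycle_edges : #|cycle_edges| = n.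
Proof. by rewrite card_imset ?card_ord //; exact: cycle_edge_inj. Qed.

Lemma parabola_pt_support (i : 'I_n) : exists2 u, u != 0 &
  forall j, j != i -> dot u (parabola_pt j) < dot u (parabola_pt i).
Proof.
(* Normal to the tangent of the parabola at the point [i]; the gap at [j] is [(j - i)^2]. *)
exists (vec2 (2 * i%:R) (-1)); first by rewrite vec2_neq0 // oppr_eq0 oner_eq0.
move=> j ji; rewrite /parabola_pt !dot_vec2 -subr_gt0.
suff -> : 2 * i%:R * i%:R + -1 * i%:R ^+ 2 - (2 * i%:R * j%:R + -1 * j%:R ^+ 2)
    = (j%:R - i%:R) ^+ 2 :> R.
  by rewrite exprn_even_gt0 //= subr_eq0 eqr_nat.
by ring.
Qed.

Lemma cycle_edge_support (i : 'I_n) : exists2 u, u != 0 & exists c, forall j,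
  if j \in cycle_edge i then dot u (parabola_pt j) = c
  else dot u (parabola_pt j) < c.
Proof.
have [lt_in|ge_in] := ltnP i.+1 n.
  (* Normal to the chord from [i] to [i + 1]; the gap [(j - i)(j - i - 1)] is positive for every
     other integer [j]. *)
  exists (vec2 (2 * i%:R + 1) (-1)).
    by rewrite vec2_neq0 // oppr_eq0 oner_eq0.
  exists (i%:R * (i%:R + 1)) => j; rewrite !inE -!val_eqE val_ordS lt_in /=.
  rewrite dot_vec2.
  have [->|ji] := eqVneq (j : nat) i; first by rewrite /=; ring.
  have [->|jSi] /= := eqVneq (j : nat) i.+1.
    by rewrite -natr1; ring.
  rewrite -subr_gt0.
  suff -> : i%:R * (i%:R + 1) - ((2 * i%:R + 1) * j%:R + -1 * j%:R ^+ 2) =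
     (j%:R - i%:R) * (j%:R - i.+1%:R) :> R.
    have [lt_ji|le_ij] := ltnP j i.
      by rewrite nmulr_lgt0 subr_lt0 ltr_nat //; lia.
    by rewrite mulr_gt0 // subr_gt0 ltr_nat; lia.
  by rewrite -natr1; ring.
(* The closing side joins [i = n - 1] to 0; the functional takes the value [j (j - i)], negative
   strictly between. *)
exists (vec2 (- i%:R) 1); first by rewrite vec2_neq0 // oner_eq0.
exists 0 => j; rewrite !inE -!val_eqE val_ordS ltnNge ge_in /= dot_vec2.
have [->|ji] := eqVneq (j : nat) i; first by rewrite /=; ring.
have [->|j0] /= := eqVneq (j : nat) 0%N; first by ring.
have -> : - i%:R * j%:R + 1 * j%:R ^+ 2 = j%:R * (j%:R - i%:R) :> R by ring.
rewrite pmulr_rlt0 ?subr_lt0 ?ltr_nat ?ltr0n; have := ltn_ord j; lia.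
Qed.

Lemma dot_midpoint_edge u (i : 'I_n) :
  dot u (midpoint parabola_pt (cycle_edge i)) =
  2^-1 * (dot u (parabola_pt i) + dot u (parabola_pt (ordS i))).
Proof.
rewrite /midpoint big_setU1 ?inE ?ordS_neq // big_set1.
by rewrite dotZr dotDr.
Qed.

Lemma parabola_pt_inj : injective parabola_pt.
Proof.
move=> i j /rowP/(_ 0); rewrite !mxE /= => /eqP.
by rewrite eqr_nat => /eqP /val_inj.
Qed.

(** The functional supporting side [j] reaches its maximum at a side midpoint only if both ends
    belong to side [j]. The one peaking at [v] alone is strictly smaller at every side midpoint. *)
Lemma parabola_drawing : is_drawing cycle_edges parabola_pt.
Proof.
split; first exact: parabola_pt_inj.
  move=> _ _ /imsetP[i _ ->] /imsetP[j _ ->] eij.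
  have [u _ [c hu]] := cycle_edge_support j.
  have := congr1 (dot u) eij; rewrite !dot_midpoint_edge.
  have := hu j; have := hu (ordS j); rewrite !inE !eqxx orbT /= => -> ->.
  move=> e; have hi := hu i; have hSi := hu (ordS i).
  have ij : i \in cycle_edge j.
    by apply: contraT => /negbTE nij; move: hi hSi; rewrite nij;
      case: ifP => _; lra.
  have Sij : ordS i \in cycle_edge j.
    by apply: contraT => /negbTE nSij; move: hi hSi; rewrite nSij;
      case: ifP => _; lra.
  apply/eqP; rewrite eqEcard !cards2 !ordS_neq /= andbT.
  by apply/fintype.subsetP => k; rewrite [k \in cycle_edge i]inE => /orP[]/set1P ->.
move=> _ v /imsetP[i _ ->] eiv; have [u _ hu] := parabola_pt_support v.
have := congr1 (dot u) eiv; rewrite dot_midpoint_edge.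
have [iv|/hu hi] := eqVneq i v; have [Siv|/hu hSi] := eqVneq (ordS i) v.
- by have := ordS_neq i; rewrite Siv iv eqxx.
- by move: hSi; rewrite -iv; lra.
- by move: hi; rewrite -Siv; lra.
- by lra.
Qed.

Lemma parabola_strictly_convex : strictly_convex (range parabola_pt).
Proof.
apply: strictly_convex_support => _ [i _ <-].
have [u _ hu] := parabola_pt_support i; exists u => _ [j _ <-].
by rewrite (inj_eq parabola_pt_inj); exact: hu.
Qed.

Lemma parabola_support x :
  (midpoints cycle_edges parabola_pt `|` range parabola_pt) x ->
  exists2 u, u != 0 &
    forall y, (midpoints cycle_edges parabola_pt `|` range parabola_pt) y ->
      dot u y <= dot u x.
Proof.
have bound u (c : R) : (forall j, dot u (parabola_pt j) <= c) ->
    forall y, (midpoints cycle_edges parabola_pt `|` range parabola_pt) y ->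
      dot u y <= c.
  move=> hu y [[_ /= /imsetP[j _ ->] <-]|[j _ <-]] //.
  by rewrite dot_midpoint_edge; have := hu j; have := hu (ordS j); lra.
case=> [[_ /= /imsetP[i _ ->] <-]|[i _ <-]].
  have [u u0 [c hu]] := cycle_edge_support i; exists u => //; apply: bound.
  rewrite dot_midpoint_edge => j.
  have := hu i; have := hu (ordS i); rewrite !inE !eqxx orbT /= => -> ->.
  by have := hu j; case: ifP => _; lra.
have [u u0 hu] := parabola_pt_support i; exists u => //; apply: bound => j.
by have [->|/hu/ltW] := eqVneq j i.
Qed.

Lemma gsw_values_double : gsw_values R n (2 * n)%N.
Proof.
have pS : parabola_pt @` [set` [set: 'I_n]%SET] = range parabola_pt.
  by apply/seteqP; split=> _ [i _ <-]; exists i => //=; rewrite inE.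
exists 'I_n, cycle_edges, parabola_pt, [set: 'I_n]%SET; split.
- by split; [exact: card_ord|exact: cycle_edges_graph].
- exact: parabola_drawing.
- exact: parabola_strictly_convex.
- apply: weakly_convex_support => x mx.
  have [|u u0 hu] := @parabola_support x; first by left.
  by exists u => // y my; apply: hu; left.
- split; last by rewrite card_cycle_edges cardsT card_ord addnn mul2n.
  by rewrite pS; apply: weakly_convex_support => x; exact: parabola_support.
Qed.

End Parabola.

Theorem theorem17 (R : realType) (n : nat) (hn : (3 <= n)%N) :
  is_gsw R n (2 * n)%N /\ is_maximum (sumset_values R n) (2 * n)%N.
Proof.
(* The value is attained by drawings and bounded for sumsets; the inclusion between the two sets of
   values carries each fact to the other. *)
have lower := @gsw_values_double R n hn.
have upper := @sumset_values_ub R n.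
split; split=> //; last exact: gsw_values_sumset.
by move=> k /gsw_values_sumset; exact: upper.
Qed.
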